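(* Let $N\ge1$, $e\geq 0$ and $d_1,\dots,d_N$ be integers. If $e\ge 1$ and the following conditions hold: $e\ge N-1$; $0<d_i\le e$ for all $i$; $\sum_{i=1}^N d_i\le e+N-1$; $N=e+1$ if and only if $\sum_{i=1}^N d_i=2e$; if $e\ge2$ then at most $e$ of the $d_i$ are equal to $1$, and if $e=1$ then at most $2$ of the $d_i$ are equal to $1$; then $$T_N(e; d_1, \dotsc, d_N) = \frac{(e-1)!}{(e+1-N)!} \binom{2e - 1- \sum_{i=1}^N d_i}{e-N} \prod_{j=1}^N d_j ,$$ with the convention $\binom{-1}{-1}=1$. For $e=0$ the only non-zero number is $T_1(0;0)=1$.
   Context: A plane tree with $e\ge1$ edges is a triple $\Gamma=(H,\alpha,\sigma)$, where $H$ is a set of $2e$ half-edges and $\alpha,\sigma$ are permutations of $H$ such that $\alpha$ is a fixed-point-free involution, the group generated by $\alpha,\sigma$ acts transitively on $H$, and $\sigma$ has exactly $e+1$ cycles (fixed points counted as cycles). Cycles of $\alpha$ are the edges, cycles of $\sigma$ are the vertices (with the cyclic order of half-edges around them), and the degree of a vertex is the length of its cycle. An $N$-rooted tree ($N\ge1$) is a plane tree together with $N$ distinct half-edges (roots) belonging to $N$ distinct cycles of $\sigma$; the corresponding $N$ vertices (root vertices) are labeled $v_1,\dots,v_N$. An isomorphism of $N$-rooted trees $(H,\alpha,\sigma)\to(H',\alpha',\sigma')$ is a bijection $\varphi:H\to H'$ with $\alpha=\varphi^{-1}\alpha'\varphi$, $\sigma=\varphi^{-1}\sigma'\varphi$,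 sending the $k$th root to the $k$th root for all $k$. Isomorphic trees are identified. As an exceptional case, the graph with one vertex (of degree $0$) and no edges counts as a one-rooted tree with $e=0$, and it is the only $N$-rooted tree with $e=0$. $T_N(e;d_1,\dots,d_N)$ is the number of $N$-rooted trees with $e$ edges in which the root vertex $v_j$ has degree $d_j$ for $j=1,\dots,N$. *)

(* Defs.v *)
From mathcomp Require Import all_boot all_order all_algebra all_fingroup.
Set Implicit Arguments.
Unset Strict Implicit.
Unset Printing Implicit Defensive.
Import GRing.Theory.

(* The cycles of s, fixed points included, are its [porbits]. *)
Definition plane_tree (e : nat) (H : finType) (a s : {perm H}) : bool :=
  [&& 0 < e, #|H| == e.*2,
      [forall x, (a x != x) && (a (a x) == x)],
      [transitive <<[set a; s]>>%g, on [set: H] | 'P%act]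
    & #|porbits s| == e.+1].

(* Candidate N-rooted trees with half-edges in H: [Some (a, s, r)] carries the
   edge involution, the vertex rotation and the roots; [None] is the graph with
   one vertex and no edges. *)
Definition rooted_graph (N : nat) (H : finType) : finType :=
  option ({perm H} * {perm H} * {ffun 'I_N -> H}).

(* Roots in distinct cycles of s are in particular distinct half-edges. *)
Definition rooted_tree (e N : nat) (H : finType) (t : rooted_graph N H) : bool :=
  match t with
  | Some (a, s, r) => plane_tree e a s && injectiveb (fun k => porbit s (r k))
  | None => (e == 0) && (N == 1)
  end.

Definition root_degree (N : nat) (H : finType) (t : rooted_graph N H)
    (k : 'I_N) : nat :=
  match t with
  | Some (_, s, r) => #|porbit s (r k)|
  | None => 0
  end.

Definition rooted_iso (N : nat) (H : finType) (t t' : rooted_graph N H) : bool :=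
  match t, t' with
  | Some (a, s, r), Some (a', s', r') =>
      [exists phi : {perm H},
        [&& [forall x, a x == (phi^-1)%g (a' (phi x))],
            [forall x, s x == (phi^-1)%g (s' (phi x))]
          & [forall k, phi (r k) == r' k]]]
  | None, None => true
  | _, _ => false
  end.

Lemma rooted_iso_equiv (N : nat) (H : finType) :
  equivalence_rel (@rooted_iso N H).
Proof.
have refl : reflexive (@rooted_iso N H).
  case=> [[[a s] r]|] //=; apply/existsP; exists 1%g.
  by apply/and3P; split; apply/forallP=> x; rewrite ?invg1 !perm1.
have sym (t t' : rooted_graph N H) : rooted_iso t t' -> rooted_iso t' t.
  case: t t' => [[[a s] r]|] [[[a' s'] r']|] //=.
  case/existsP=> p /and3P[/forallP pa /forallP ps /forallP pr].
  apply/existsP; exists p^-1%g; apply/and3P; split; apply/forallP=> x.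
  - by rewrite invgK (eqP (pa _)) !permKV.
  - by rewrite invgK (eqP (ps _)) !permKV.
  - by rewrite -(eqP (pr _)) permK.
have trans (t2 t1 t3 : rooted_graph N H) :
    rooted_iso t1 t2 -> rooted_iso t2 t3 -> rooted_iso t1 t3.
  case: t1 t2 t3 => [[[a s] r]|] [[[a' s'] r']|] [[[a'' s''] r'']|] //=.
  case/existsP=> p /and3P[/forallP pa /forallP ps /forallP pr].
  case/existsP=> q /and3P[/forallP qa /forallP qs /forallP qr].
  apply/existsP; exists (p * q)%g; apply/and3P; split; apply/forallP=> x.
  - by rewrite invMg !permM (eqP (pa _)) (eqP (qa _)).
  - by rewrite invMg !permM (eqP (ps _)) (eqP (qs _)).
  - by rewrite permM (eqP (pr _)) (eqP (qr _)).
move=> t1 t2 t3; split=> [|t12]; first exact: refl.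
by apply/idP/idP; [apply: trans; exact: sym | exact: trans].
Qed.

(* The number of isomorphism classes; up to isomorphism the 2e half-edges may
   be taken to be the elements of ['I_(e.*2)]. *)
Definition tree_count (N e : nat) (d : 'I_N -> int) : nat :=
  #|equivalence_partition (@rooted_iso N 'I_(e.*2))
      [set t : rooted_graph N 'I_(e.*2)
        | rooted_tree e t & [forall k, (root_degree t k)%:Z%R == d k]]|.

(* Binomial coefficient with integer arguments and the convention
   binom(-1, -1) = 1; all other pairs with a negative entry get the value 0. *)
Definition binz (m k : int) : nat :=
  match m, k with
  | Posz m', Posz k' => 'C(m', k')
  | Negz 0, Negz 0 => 1
  | _, _ => 0
  end.

(* Main.v *)
Require Import Defs.
From mathcomp Require Import all_boot all_order all_algebra all_fingroup.
From mathcomp Require Import zify ring.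
Import Order.TTheory GRing.Theory Num.Theory.
Local Open Scope ring_scope.
Set Implicit Arguments.
Unset Strict Implicit.
Unset Printing Implicit Defensive.

(** Trees are counted on a fixed set H of 2e half-edges first.  Rooted trees are
    rigid: an isomorphism that fixes a root fixes everything that the two
    permutations reach from it, hence all of H.  So the (2e)! bijections of H act
    freely, and T_N is the number of labelled triples (alpha, sigma, r) divided by
    (2e)! ([card_isoclasses]).

    For a fixed sigma with e + 1 cycles, connectedness of (alpha, sigma) depends
    only on the partition of H into the cycles of sigma, and exactly
    (e - 1)! * prod_C #|C| involutions alpha give a tree
    ([card_tree_matchings]).  This is proved by induction, removing a leaf h and
    its partner h': if h' sits at a vertex of degree d_y, the product for the
    smaller tree has d_y - 1 in place of d_y, and summing over the d_y choices of
    h' at each y the total is (e - 2)! * prod_C #|C| * sum_y (d_y - 1), where the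
    last sum is e - 1.

    It remains to sum prod_C #|C| over the pairs (sigma, r) with prescribed root
    degrees d_j.  The root cycles contribute the constant prod_j d_j.  For the
    M = e + 1 - N other cycles, M! times the product of their lengths is the
    number of ways to label them by 1, ..., M and to choose a root in each
    ([card_labelled_sections]), so the weighted sum becomes a plain count of
    permutations all of whose cycles are labelled and rooted
    ([complete_rooted_perms_weight]).  When all the cycle lengths are prescribed
    there are (2e)! of those, since such a permutation is a bijection between H
    and the set of pairs (cycle, position in the cycle) ([card_rooted_perms]).
    Finally the M free lengths run over the compositions of 2e - sum_j d_j into M
    positive parts, and there are binom(2e - 1 - sum_j d_j, M - 1) of them; for
    M = 0 this is the empty composition of 0, which is what the convention
    binom(-1, -1) = 1 counts.  The factor (2e)! cancels. *)

(** * Matchings that form a tree *)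

Lemma card_fibers (S T : finType) (f : S -> T) (X : {set S}) (Y : {set T}) :
  {in X, forall x, f x \in Y} ->
  (#|X| = \sum_(y in Y) #|[set x in X | f x == y]|)%N.
Proof.
move=> XY; rewrite -sum1_card (partition_big f (mem Y)) //=.
by apply: eq_bigr => y _; rewrite -sum1dep_card.
Qed.

Section Matchings.
Local Open Scope nat_scope.
Variables (H V : finType) (v : H -> V).

(** The graph whose vertices are the values of [v] and whose edges join [v x] to
    [v (a x)], for x in A, is connected: no proper nonempty subset of the
    half-edges is closed under following an edge and under turning around a
    vertex. *)
Definition connecting (A : {set H}) (a : {perm H}) : bool :=
  [forall B : {set H},
    [&& B \subset A, B != set0, [forall x in B, a x \in B]
      & [forall x in B, forall y in A, (v x == v y) ==> (y \in B)]] ==>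
    (B == A)].

Definition tree_matchings (A : {set H}) : {set {perm H}} :=
  [set a | [&& perm_on A a, [forall x in A, (a x != x) && (a (a x) == x)]
             & connecting A a]].

Definition fiber (A : {set H}) (w : V) : {set H} := [set x in A | v x == w].

Lemma connectingP (A : {set H}) (a : {perm H}) :
  reflect (forall B : {set H}, B \subset A ->
             {in B, forall x, a x \in B} ->
             {in B & A, forall x y, v x = v y -> y \in B} ->
             forall z, z \in B -> B = A)
          (connecting A a).
Proof.
apply: (iffP forallP) => [cA B sBA aB vB z zB|cA B].
  apply/eqP; apply: (implyP (cA B)); rewrite sBA /=; apply/and3P; split.
  - by apply/set0Pn; exists z.
  - by apply/forall_inP.
  - apply/forall_inP=> x xB; apply/forall_inP=> y yA.
    by apply/implyP=> /eqP; apply: vB.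
apply/implyP=> /and4P[sBA /set0Pn[z zB] /forall_inP aB /forall_inP vB].
apply/eqP; apply: (cA B sBA aB _ z zB) => x y xB yA /eqP vxy.
by have /forall_inP/(_ y yA)/implyP := vB x xB; apply.
Qed.

Lemma tree_matchingsP (A : {set H}) (a : {perm H}) :
  reflect [/\ perm_on A a, {in A, forall x, a x != x},
              {in A, forall x, a (a x) = x} & connecting A a]
          (a \in tree_matchings A).
Proof.
rewrite inE; apply: (iffP and3P) => [[pa /forall_inP fa ca]|[pa fa ia ca]].
  by split=> // x xA; have /andP[] := fa x xA => // _ /eqP.
by split=> //; apply/forall_inP=> x xA; rewrite fa //= ia.
Qed.

(** Throughout, h is the only half-edge at its vertex and h' is the candidate
    partner of h.  Multiplying by the transposition of h and h' switches
    between the matchings of A that pair them and the matchings of the rest. *)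
Section LeafRemoval.
Variables (A : {set H}) (h : H).
Hypotheses (hA : h \in A) (leaf : fiber A (v h) = [set h]).

Lemma leafP y : y \in A -> v y = v h -> y = h.
Proof.
move=> yA vy; have : y \in fiber A (v h) by rewrite inE yA vy eqxx.
by rewrite leaf inE => /eqP.
Qed.

Variable h' : H.
Hypotheses (h'A : h' \in A) (neq_h : h' != h).

Let A' := A :\ h :\ h'.

Let memA' y : (y \in A') = [&& y != h', y != h & y \in A].
Proof. by rewrite !inE. Qed.

Lemma fiber_leaf_neighbour : fiber A' (v h') = fiber A (v h') :\ h'.
Proof.
apply/setP=> y; rewrite !inE; case: eqP => //= _.
case: eqP => //= ->; rewrite hA /=.
by apply/esym/negbTE; apply: contra neq_h => /eqP vh; rewrite (@leafP h').
Qed.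

Lemma fiber_leaf_other w : w != v h -> w != v h' -> fiber A' w = fiber A w.
Proof.
move=> wh wh'; apply/setP=> y; rewrite !inE.
case: eqP => [->|_] /=; first by rewrite [v h' == w]eq_sym (negbTE wh') andbF.
by case: eqP => [->|_] //=; rewrite [v h == w]eq_sym (negbTE wh) andbF.
Qed.


Lemma swap_leafE (a : {perm H}) x :
  a x != h -> a x != h' -> (a * tperm h h')%g x = a x.
Proof. by move=> ah ah'; rewrite permM tpermD // eq_sym. Qed.

Lemma matching_leaf a :
  a \in tree_matchings A -> a h = h' ->
  {in A', forall x, (a x \in A') && ((a * tperm h h')%g x == a x)}.
Proof.
case/tree_matchingsP=> pa _ ia _ ah x; rewrite !memA' => /and3P[xh' xh xA].
have axh' : a x != h' by rewrite -ah (inj_eq perm_inj).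
have axh : a x != h by apply: contra xh' => /eqP axh; rewrite -ah -axh ia.
by rewrite axh' axh perm_closed // xA swap_leafE //= eqxx.
Qed.

(** A leaf cannot be joined to another leaf unless the pair is the whole tree. *)
Lemma leaf_matching_neighbour a :
  a \in tree_matchings A -> a h = h' -> 2 < #|A| ->
  exists2 y, y \in A' & v y = v h'.
Proof.
case/tree_matchingsP=> pa _ ia ca ah A2.
have [y yF|F0] := pickP (mem (fiber A' (v h'))).
  by move: yF; rewrite /= inE => /andP[yA /eqP vy]; exists y.
have hh'A : [set h; h'] = A.
  apply: (connectingP _ _ ca _ _ _ _ h); last by rewrite !inE eqxx.
  - by apply/subsetP=> y; rewrite !inE => /orP[]/eqP->.
  - by move=> y; rewrite !inE => /orP[]/eqP->; rewrite -?ah ?ia ?eqxx ?orbT.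
  move=> x y; rewrite !inE => /orP[]/eqP-> yA vxy; first by rewrite (leafP yA) ?eqxx.
  have := F0 y; rewrite /= inE memA' yA vxy eqxx.
  by case: (y == h'); case: (y == h).
by move: A2; rewrite -hh'A cards2; case: (_ != _).
Qed.

(** A closed subset of A :\ h :\ h' that avoids the vertex of h' is closed in A
    as well; one that meets this vertex becomes closed in A when h and h' are added. *)
Lemma leaf_matching_restrict a :
  a \in tree_matchings A -> a h = h' -> (a * tperm h h')%g \in tree_matchings A'.
Proof.
move=> aT ah; have aA' := matching_leaf aT ah.
case/tree_matchingsP: aT => pa fa ia ca.
have bE x : x \in A' -> (a * tperm h h')%g x = a x by case/aA'/andP=> _ /eqP.
apply/tree_matchingsP; split.
- apply/subsetP=> x; rewrite inE memA' => bx; apply/and3P; split.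
  + by apply: contra bx => /eqP->; rewrite permM -ah ia ?ah ?tpermL.
  + by apply: contra bx => /eqP->; rewrite permM ah ?tpermR.
  + apply: contraR bx => xA; rewrite permM (out_perm pa) // tpermD //.
      by apply: contraNneq xA => <-.
    by apply: contraNneq xA => <-.
- by move=> x xA; rewrite bE // fa //; move: xA; rewrite memA' => /and3P[].
- move=> x xA; have /andP[axA _] := aA' x xA.
  by rewrite (bE x xA) bE // ia //; move: xA; rewrite memA' => /and3P[].
apply/connectingP=> B sBA' bB vB z zB.
have sBA : B \subset A.
  by apply: subset_trans sBA' _; apply/subsetP=> y; rewrite memA' => /and3P[].
have aB x : x \in B -> a x \in B by move=> xB; rewrite -bE ?(subsetP sBA') // bB.
have [y /andP[yB /eqP vy]|noB] := pickP (fun y => (y \in B) && (v y == v h')).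
  have BA : h |: (h' |: B) = A.
    apply: (connectingP _ _ ca _ _ _ _ h); last by rewrite !inE eqxx.
    - by rewrite !subUset !sub1set hA h'A.
    - move=> x; rewrite !inE => /or3P[/eqP->|/eqP->|/aB ->]; rewrite ?orbT //.
        by rewrite ah eqxx orbT.
      by rewrite -ah ia ?eqxx.
    move=> x t xB tA vxt; rewrite !inE.
    have [//|th] := eqVneq t h; have [//|th'] := eqVneq t h' => /=.
    have tA' : t \in A' by rewrite memA' th th'.
    move: xB; rewrite !inE => /or3P[/eqP xE|/eqP xE|xB].
    - by rewrite (leafP tA) ?eqxx // -vxt xE in th.
    - by apply: vB yB tA' _; rewrite vy -xE.
    - exact: vB xB tA' vxt.
  apply/eqP; rewrite eqEsubset sBA'; apply/subsetP=> t.
  by rewrite memA' => /and3P[th' th]; rewrite -BA !inE (negbTE th) (negbTE th').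
have BA : B = A.
  apply: (connectingP _ _ ca _ sBA aB _ z zB) => x y xB yA vxy.
  have [yh|yh] := eqVneq y h.
    have := subsetP sBA' _ xB; rewrite memA' => /and3P[_ xh xA].
    by rewrite (leafP xA) ?eqxx // vxy yh in xh.
  have [yh'|yh'] := eqVneq y h'.
    by have := noB x; rewrite xB vxy yh' eqxx.
  by apply: vB xB _ vxy; rewrite memA' yh yh'.
by have := subsetP sBA' h; rewrite memA' eqxx andbF BA => /(_ hA).
Qed.

(** The half-edge y keeps the vertex of h' alive when h' is removed: without it
    the pair h, h' would be a component of its own. *)
Lemma leaf_matching_extend y a :
  y \in A' -> v y = v h' -> a \in tree_matchings A' ->
  (a * tperm h h')%g \in tree_matchings A.
Proof.
move=> yA' vy /tree_matchingsP[pa fa ia ca].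
have ah : a h = h by apply: (out_perm pa); rewrite memA' eqxx andbF.
have ah' : a h' = h' by apply: (out_perm pa); rewrite memA' eqxx.
have bE x : x \in A' -> (a * tperm h h')%g x = a x.
  rewrite -(perm_closed x pa) memA' => /and3P[axh' axh _].
  exact: swap_leafE.
have bh : (a * tperm h h')%g h = h' by rewrite permM ah tpermL.
have bh' : (a * tperm h h')%g h' = h by rewrite permM ah' tpermR.
have A'P x : x \in A -> [\/ x = h, x = h' | x \in A'].
  move=> xA; rewrite memA' xA andbT.
  have [->|_] := eqVneq x h; first by constructor 1.
  by have [->|_] := eqVneq x h'; [constructor 2 | constructor 3].
have sA'A : A' \subset A by apply/subsetP=> x; rewrite memA' => /and3P[].
apply/tree_matchingsP; split.
- apply/subsetP=> x; rewrite inE; apply: contraR => xA.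
  rewrite permM (out_perm pa) ?(contra (subsetP sA'A x)) //.
  by rewrite tpermD //; apply: contraNneq xA => <-.
- move=> x /A'P[->|->|xA']; rewrite ?bh ?bh' //; first by rewrite eq_sym.
  by rewrite bE // fa.
- move=> x /A'P[->|->|xA']; rewrite ?bh ?bh' ?bh //.
  by rewrite bE // bE ?ia // perm_closed.
apply/connectingP=> B sBA bB vB.
have hh' : h' \in B -> h \in B by move=> h'B; rewrite -bh'; apply: bB.
have yB : B :&: A' != set0 -> y \in B.
  case/set0Pn=> z zB.
  have BA' : B :&: A' = A'.
    apply: (connectingP _ _ ca _ _ _ _ z zB); first exact: subsetIr.
      move=> x; rewrite !in_setI => /andP[xB xA'].
      by rewrite (perm_closed _ pa) xA' -bE // bB.
    move=> x t; rewrite !in_setI => /andP[xB xA'] tA' vxt.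
    by rewrite tA' andbT (vB x t) // (subsetP sA'A).
  by move: yA'; rewrite -BA' inE => /andP[].
have hB z : z \in B -> y \in B.
  move=> zB; suff h'B : h' \in B.
    by apply: (vB h' y) => //; apply: (subsetP sA'A).
  have /A'P[zE|<- //|zA'] := subsetP sBA z zB.
    by rewrite -bh bB -?zE.
  apply: (vB y h') => //; apply: yB; apply/set0Pn; exists z.
  by rewrite inE zB.
move=> z /hB yinB; have h'B : h' \in B by apply: (vB y h').
have BA' : B :&: A' = A'.
  apply: (connectingP _ _ ca _ _ _ _ y); first exact: subsetIr.
  - move=> x; rewrite !in_setI => /andP[xB xA'].
    by rewrite (perm_closed _ pa) xA' -bE // bB.
  - move=> x t; rewrite !in_setI => /andP[xB xA'] tA' vxt.
    by rewrite tA' andbT (vB x t) // (subsetP sA'A).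
  - by rewrite inE yinB.
apply/eqP; rewrite eqEsubset sBA; apply/subsetP=> x /A'P[->|->|].
- exact: hh'.
- exact: h'B.
- by rewrite -BA' inE => /andP[].
Qed.

(** The degree-one case has to be separated because the vertex of h' then
    disappears with h', so that the smaller set has one vertex too few. *)
Lemma card_leaf_matchings :
  2 < #|A| ->
  #|[set a in tree_matchings A | a h == h']| =
  if #|fiber A (v h')| == 1 then 0 else #|tree_matchings A'|.
Proof.
move=> A2; case: ifP => [/cards1P[x Fx]|Fh'].
  apply: eq_card0 => a; rewrite inE; apply/negP=> /andP[aT /eqP ah].
  have [y yA' vy] := leaf_matching_neighbour aT ah A2.
  have: h' \in fiber A (v h') by rewrite inE h'A eqxx.
  have: y \in fiber A (v h').
    by move: yA'; rewrite memA' inE vy eqxx => /and3P[_ _ ->].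
  rewrite Fx !inE => /eqP yx /eqP h'x.
  by rewrite memA' yx h'x eqxx in yA'.
have [y yA' vy] : exists2 y, y \in A' & v y = v h'.
  have [y yF|F0] := pickP (mem (fiber A' (v h'))).
    by move: yF; rewrite /= inE => /andP[yA /eqP vy]; exists y.
  case/eqP: Fh'; rewrite (cardsD1 h') inE h'A eqxx -fiber_leaf_neighbour.
  by rewrite (eq_card0 F0).
rewrite -(card_imset (tree_matchings A') (mulIg (tperm h h'))).
apply: eq_card => a; rewrite inE; apply/andP/imsetP=> [[aT /eqP ah]|[b bT ->]].
  exists (a * tperm h h')%g; first exact: leaf_matching_restrict.
  by rewrite -mulgA tperm2 mulg1.
split; first exact: leaf_matching_extend vy bT.
case/tree_matchingsP: bT => pb _ _ _; rewrite permM (out_perm pb) ?tpermL //.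
by rewrite memA' eqxx andbF.
Qed.

End LeafRemoval.

Lemma fiber_gt0 (A : {set H}) (w : V) : (0 < #|fiber A w|) = (w \in v @: A).
Proof.
rewrite card_gt0; apply/set0Pn/imsetP=> [[x]|[x xA ->]].
  by rewrite inE => /andP[xA /eqP <-]; exists x.
by exists x; rewrite inE xA eqxx.
Qed.

Lemma card_sum_fibers (A : {set H}) : #|A| = \sum_(w in v @: A) #|fiber A w|.
Proof. by apply: card_fibers => x xA; apply: imset_f. Qed.

Lemma prod_fibers_leaf_neighbour (A : {set H}) (h h' : H) :
  h \in A -> fiber A (v h) = [set h] -> h' \in A -> h' != h ->
  1 < #|fiber A (v h')| ->
  let A' := A :\ h :\ h' in
  v @: A' = v @: A :\ v h /\
  \prod_(w in v @: A') #|fiber A' w| =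
    #|fiber A (v h')|.-1 *
      \prod_(w in v @: A :\ v h | w != v h') #|fiber A w|.
Proof.
move=> hA leaf h'A neq_h d1 A'.
have fh' : fiber A' (v h') = fiber A (v h') :\ h' by apply: fiber_leaf_neighbour.
have ch' : #|fiber A (v h')|.-1 = #|fiber A' (v h')|.
  by rewrite fh' (cardsD1 h' (fiber _ _)) inE h'A eqxx.
have nvh : v h' != v h by apply: contra neq_h => /eqP /(leafP leaf h'A) ->.
have vA' : v @: A' = v @: A :\ v h.
  apply/setP=> w; rewrite -fiber_gt0 !inE.
  have [->|wh] := eqVneq w (v h); first apply/negbTE; rewrite /= -?fiber_gt0.
    rewrite -eqn0Ngt cards_eq0 -subset0; apply/subsetP=> y; rewrite !inE.
    by case/andP=> /and3P[_ /eqP yh yA] /eqP vy; case: yh; exact: (leafP leaf yA vy).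
  have [->|wh'] := eqVneq w (v h'); last by rewrite fiber_leaf_other.
  by rewrite -ch'; move: d1; case: #|_| => [|[]].
split=> //; rewrite vA' (bigD1 (v h')) /=; last by rewrite !inE nvh imset_f.
rewrite ch'; congr (_ * _); apply: eq_bigr => w; rewrite !inE => /andP[/andP[wh _] wh'].
by rewrite fiber_leaf_other.
Qed.

(** Otherwise the degrees would add up to at least 2(e + 1). *)
Lemma exists_leaf (A : {set H}) e :
  #|A| = e.*2 -> #|v @: A| = e.+1 -> exists2 h, h \in A & fiber A (v h) = [set h].
Proof.
move=> cA cvA.
have [w|nL] := pickP [pred w in v @: A | #|fiber A w| == 1].
  case/andP=> _ /cards1P[h Fw]; have : h \in fiber A w by rewrite Fw inE.
  by rewrite inE => /andP[hA /eqP vh]; exists h; rewrite ?vh.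
have : \sum_(w in v @: A) 2 <= #|A|.
  rewrite card_sum_fibers; apply: leq_sum => w wvA.
  have := nL w; rewrite /= wvA /=; move: wvA; rewrite -fiber_gt0.
  by case: #|_| => [|[]].
rewrite sum_nat_const cvA cA; lia.
Qed.

(** The formula depends on the vertex degrees only through their product, so it
    survives the removal of a leaf.  A neighbour of degree 1 contributes 0 on both
    sides of the induction, thanks to the factor [(d w).-1]. *)
Lemma card_tree_matchings e (A : {set H}) :
  #|A| = e.+1.*2 -> #|v @: A| = e.+2 ->
  #|tree_matchings A| = e`! * \prod_(w in v @: A) #|fiber A w|.
Proof.
elim: e A => [|e IHe] A cA cvA.
  have /cards2P[x [y [nxy defA]]] : #|A| == 2 by rewrite cA.
  have vinj : {in A &, injective v} by apply/imset_injP; rewrite cA cvA.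
  rewrite fact0 mul1n big1 => [|_ /imsetP[z zA ->]]; last first.
    apply/eqP/cards1P; exists z; apply/setP=> t; rewrite !inE.
    apply/andP/eqP=> [[tA /eqP]|->]; [exact: vinj | by rewrite zA eqxx].
  apply/eqP/cards1P; exists (tperm x y); apply/setP=> a; rewrite inE.
  have xA : x \in A by rewrite defA !inE eqxx.
  have yA : y \in A by rewrite defA !inE eqxx orbT.
  apply/tree_matchingsP/eqP=> [[pa fa ia _]|->].
    have ax : a x = y.
      have := fa x xA; have := perm_closed x pa; rewrite xA defA !inE.
      by case/orP=> /eqP->; rewrite ?eqxx.
    have ay : a y = x by rewrite -ax ia.
    apply/permP=> z; case: tpermP => [->|->|/eqP zx /eqP zy] //.
    by rewrite (out_perm pa) // defA !inE (negbTE zx).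
  split.
  - apply/subsetP=> z; rewrite inE; apply: contraR => zA.
    by rewrite tpermD //; apply: contraNneq zA => <-.
  - by move=> z; rewrite defA !inE => /orP[]/eqP->; rewrite ?tpermL ?tpermR // eq_sym.
  - by move=> z _; rewrite tpermK.
  apply/connectingP=> B sBA aB _ z zB; apply/eqP; rewrite eqEsubset sBA /=.
  have := aB z zB; have := subsetP sBA z zB; rewrite defA !inE.
  by case/orP=> /eqP zE; rewrite zE ?tpermL ?tpermR => tB;
    apply/subsetP=> t; rewrite !inE => /orP[]/eqP-> //; rewrite -zE.
have [h hA leaf] := exists_leaf cA cvA.
pose d w := #|fiber A w|; pose W := v @: A :\ v h.
pose G w := e`! * ((d w).-1 * \prod_(u in W | u != w) d u).
have dh : d (v h) = 1 by rewrite /d leaf cards1.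
have vhA : v h \in v @: A by apply: imset_f.
(* Classify the matchings by the partner h' of the leaf h. *)
transitivity (\sum_(h' in A :\ h) G (v h')).
  rewrite (card_fibers (f := fun a : {perm H} => a h) (Y := A :\ h)); last first.
    by move=> a /tree_matchingsP[pa fa _ _]; rewrite !inE fa // perm_closed.
  apply: eq_bigr => h' /setD1P[neq_h h'A].
  rewrite card_leaf_matchings //; last by rewrite cA.
  case: ifP => [/eqP d1|d1]; first by rewrite /G /d d1 muln0.
  have d2 : 1 < d (v h').
    have : 0 < d (v h') by rewrite fiber_gt0 imset_f.
    by rewrite /d; move: d1; case: #|_| => [|[]].
  have [vA' pA'] := prod_fibers_leaf_neighbour hA leaf h'A neq_h d2.
  rewrite IHe ?pA' //; last by move: cvA; rewrite vA' (cardsD1 (v h)) vhA => -[].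
  move: cA; rewrite (cardsD1 h A) hA (cardsD1 h' (A :\ h)) !inE neq_h h'A.
  by rewrite !doubleS => -[].
(* Group the partners h' by their vertex w: there are d w of them at w, which
   restores the factor missing from G w. *)
rewrite (partition_big v (mem W)) /= => [|y /setD1P[yh yA]]; last first.
  rewrite !inE imset_f // andbT; apply: contra yh => /eqP vy.
  by rewrite (leafP leaf yA vy).
pose P := \prod_(w in W) d w.
transitivity (\sum_(w in W) e`! * P * (d w).-1).
  apply: eq_bigr => w /setD1P[wh wA].
  under eq_bigr => y /andP[_ /eqP ->] do over.
  rewrite (eq_bigl (mem (fiber A w))) => [|y]; last first.
    rewrite !inE; case: (eqVneq y h) => //= ->.
    by rewrite [v h == w]eq_sym (negbTE wh) andbF.
  have -> : P = d w * \prod_(u in W | u != w) d u.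
    by rewrite /P (bigD1 w) // !inE wh.
  rewrite sum_nat_const -/(d w) /G; ring.
rewrite -big_distrr /= factS -/d.
have -> : \prod_(w in v @: A) d w = P.
  by rewrite (bigD1 (v h)) //= dh mul1n; apply: eq_bigl => w; rewrite !inE andbC.
suff -> : \sum_(w in W) (d w).-1 = e.+1 by ring.
have : \sum_(w in W) ((d w).-1 + 1) = \sum_(w in W) d w.
  apply: eq_bigr => w /setD1P[_]; rewrite -fiber_gt0 addn1; exact: prednK.
have cW : #|W| = e.+2.
  by move: cvA; rewrite (cardsD1 (v h)) vhA => -[].
have : \sum_(w in v @: A) d w = e.+2.*2 by rewrite -card_sum_fibers.
rewrite (bigD1 (v h)) //= dh (eq_bigl (mem W)) => [|w]; last first.
  by rewrite !inE andbC.
rewrite big_split /= sum_nat_const cW; lia.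
Qed.

End Matchings.

(** * Plane trees and their isomorphism classes *)

Section PlaneTrees.
Local Open Scope nat_scope.
Variables (H : finType).
Implicit Types (a s p : {perm H}).

Lemma porbit_step s x : porbit s (s x) = porbit s x.
Proof. exact: (porbit_perm s 1). Qed.

(** The orbit of x0 is closed under a and s; conversely a set closed under the
    generators is stable under the whole group. *)
Lemma connecting_transitive a s (x0 : H) :
  connecting (porbit s) setT a =
  [transitive <<[set a; s]>>%g, on [set: H] | 'P%act].
Proof.
set G := <<_>>%g.
have aG : a \in G by rewrite mem_gen // !inE eqxx.
have sG : s \in G by rewrite mem_gen // !inE eqxx orbT.
apply/connectingP/idP=> [conn | trG B _ aB sB z zB].
  apply/imsetP; exists x0; rewrite ?inE //; apply/esym.
  apply: (conn _ (subsetT _) _ _ x0); last exact: orbit_refl.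
    move=> x /orbitP[g gG <-]; apply/orbitP; exists (g * a)%g; first exact: groupM.
    by rewrite /= !apermE permM.
  move=> x y /orbitP[g gG <-] _ /eqP.
  rewrite eq_sym eq_porbit_mem => /porbitP[i ->].
  apply/orbitP; exists (g * s ^+ i)%g; first by rewrite groupM ?groupX.
  by rewrite /= !apermE permM.
have sGN : G \subset ('N(B | 'P))%g.
  rewrite gen_subG; apply/subsetP=> g; rewrite !inE => gas; apply/subsetP=> x xB.
  rewrite inE /= apermE; case/orP: gas => /eqP->; first exact: aB.
  by apply: (sB x) => //; rewrite ?inE // porbit_step.
apply/setP=> y; rewrite inE.
have /(atransP2 trG (in_setT z)) [g gG ->] : y \in [set: H] by rewrite inE.
by rewrite (astabs_act _ (subsetP sGN g gG)) zB.
Qed.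

Lemma plane_treeE e a s :
  plane_tree e a s =
  [&& 0 < e, #|H| == e.*2, #|porbits s| == e.+1
    & a \in tree_matchings (porbit s) setT].
Proof.
rewrite /plane_tree; case: (posnP e) => //= e0; case: eqP => //= cH.
have [x0 _] : exists x0 : H, x0 \in H by apply/card_gt0P; rewrite cH double_gt0.
rewrite -connecting_transitive // inE.
have -> : perm_on setT a by apply/subsetP=> x _; rewrite inE.
have -> : [forall x in [set: H], (a x != x) && (a (a x) == x)] =
          [forall x, (a x != x) && (a (a x) == x)].
  by apply: eq_forallb => x; rewrite inE.
by rewrite andbA andbC.
Qed.

Lemma fiber_porbit s C : C \in porbits s -> fiber (porbit s) setT C = C.
Proof.
by case/imsetP=> x _ ->; apply/setP=> y; rewrite !inE /= eq_porbit_mem.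
Qed.

Lemma imset_porbit s : porbit s @: setT = porbits s.
Proof.
by apply/setP=> C; apply/imsetP/imsetP=> -[x _ ->]; exists x; rewrite ?inE.
Qed.

Lemma card_plane_matchings e s :
  #|H| = e.+1.*2 -> #|porbits s| = e.+2 ->
  #|tree_matchings (porbit s) setT| = e`! * \prod_(C in porbits s) #|C|.
Proof.
move=> cH cs; rewrite (card_tree_matchings (e := e)) ?cardsT ?imset_porbit //.
by congr (_ * _); apply: eq_bigr => C Cs; rewrite fiber_porbit.
Qed.

Lemma porbitJ s p x : porbit (s ^ p)%g (p x) = p @: porbit s x.
Proof.
apply/setP=> y; apply/porbitP/imsetP=> [[i ->]|[_ /porbitP[i ->] ->]].
  by exists ((s ^+ i)%g x); rewrite ?mem_porbit // -conjXg permJ.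
by exists i; rewrite -conjXg permJ.
Qed.

Lemma card_porbitsJ s p : #|porbits (s ^ p)%g| = #|porbits s|.
Proof.
rewrite -(card_imset (porbits s) (imset_inj (@perm_inj _ p))).
apply: eq_card => C; apply/imsetP/imsetP=> [[y _ ->]|[_ /imsetP[x _ ->] ->]].
  exists (porbit s ((p^-1)%g y)); first by apply/imsetP; exists ((p^-1)%g y).
  by rewrite -porbitJ permKV.
by exists (p x); rewrite // porbitJ.
Qed.

Lemma connectingJ a s p :
  connecting (porbit s) setT a ->
  connecting (porbit (s ^ p)%g) setT (a ^ p)%g.
Proof.
move/connectingP=> conn; apply/connectingP=> B _ aB sB z zB.
suff pB : p @^-1: B = setT.
  apply/setP=> y; rewrite [RHS]inE; have := in_setT ((p^-1)%g y).
  by rewrite -pB inE permKV.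
apply: (conn _ (subsetT _) _ _ ((p^-1)%g z)); last by rewrite inE permKV.
  by move=> x; rewrite !inE -permJ; apply: aB.
move=> x y; rewrite !inE => xB _ pxy; apply: sB xB _ _ => //.
by rewrite !porbitJ pxy.
Qed.

Lemma plane_treeJ e a s p : plane_tree e a s -> plane_tree e (a ^ p)%g (s ^ p)%g.
Proof.
rewrite !plane_treeE card_porbitsJ => /and4P[-> -> -> /tree_matchingsP[_ fa ia ca]] /=.
apply/tree_matchingsP; split; last exact: connectingJ.
- by apply/subsetP=> x _; rewrite inE.
- by move=> y _; rewrite -(permKV p y) permJ (inj_eq perm_inj) fa ?inE.
- by move=> y _; rewrite -(permKV p y) !permJ ia ?inE.
Qed.

Section Relabel.
Variable N : nat.
Implicit Types t : rooted_graph N H.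

Definition relabel t p : rooted_graph N H :=
  match t with
  | Some (a, s, r) => Some ((a ^ p)%g, (s ^ p)%g, [ffun k => p (r k)])
  | None => None
  end.

Lemma rooted_isoP t t' : reflect (exists p, t' = relabel t p) (rooted_iso t t').
Proof.
case: t t' => [[[a s] r]|] [[[a' s'] r']|] /=; last 1 first.
- by apply: ReflectT; exists 1%g.
- apply: (iffP existsP) => [[p /and3P[/forallP pa /forallP ps /forallP pr]]|].
    have -> : a' = (a ^ p)%g.
      by apply/permP=> y; rewrite -{2}(permKV p y) permJ (eqP (pa _)) !permKV.
    have -> : s' = (s ^ p)%g.
      by apply/permP=> y; rewrite -{2}(permKV p y) permJ (eqP (ps _)) !permKV.
    have -> : r' = [ffun k => p (r k)].
      by apply/ffunP=> k; rewrite ffunE (eqP (pr k)).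
    by exists p.
  case=> p [-> -> ->]; exists p; apply/and3P; split; apply/forallP=> x.
  + by rewrite permJ permK.
  + by rewrite permJ permK.
  + by rewrite ffunE.
- by apply: ReflectF => -[].
- by apply: ReflectF => -[].
Qed.

Lemma rooted_tree_relabel e t p : rooted_tree e t -> rooted_tree e (relabel t p).
Proof.
case: t => [[[a s] r]|] //= /andP[pt /injectiveP ri]; rewrite plane_treeJ //=.
apply/injectiveP=> k l; rewrite !ffunE !porbitJ => /(imset_inj (@perm_inj _ p)).
exact: ri.
Qed.

Lemma root_degree_relabel t p k : root_degree (relabel t p) k = root_degree t k.
Proof.
by case: t => [[[a s] r]|] //=; rewrite ffunE porbitJ (card_imset _ (@perm_inj _ p)).
Qed.

(** Rigidity: the set where two relabellings with the same result agree is closed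
    under a and s and contains the first root. *)
Lemma relabel_inj e t : 0 < e -> 0 < N -> rooted_tree e t -> injective (relabel t).
Proof.
case: t => [[[a s] r]|] /=; last by case: e.
move=> _ N0 /andP[]; rewrite plane_treeE => /and4P[_ _ _ /tree_matchingsP[_ _ _]].
move=> /connectingP conn _ p q [pqa pqs pqr].
suff pqT : [set x | p x == q x] = setT.
  by apply/permP=> x; have := in_setT x; rewrite -pqT inE => /eqP.
have stepP u x : (u ^ p = u ^ q)%g -> p x = q x -> p (u x) = q (u x).
  by move=> upq pqx; rewrite -permJ upq pqx permJ.
apply: (conn _ (subsetT _) _ _ (r (Ordinal N0))).
- by move=> x; rewrite !inE => /eqP pqx; rewrite stepP.
- move=> x y; rewrite !inE => /eqP pqx _ /eqP.
  rewrite eq_sym eq_porbit_mem => /porbitP[i ->]; apply/eqP.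
  elim: i => [|i IHi]; first by rewrite perm1.
  by rewrite expgSr permM stepP.
- by have /ffunP/(_ (Ordinal N0)) := pqr; rewrite !ffunE inE => ->.
Qed.

Lemma card_perm_type : #|{perm H}| = #|H|`!.
Proof.
rewrite -(cardsT H) -card_perm; apply: eq_card => p; rewrite [LHS]inE.
by apply/esym/subsetP=> x; rewrite inE.
Qed.

Lemma card_isoclasses e (d : 'I_N -> int) :
  0 < e -> 0 < N ->
  let D := [set t : rooted_graph N H
      | rooted_tree e t & [forall k, (root_degree t k)%:Z%R == d k]] in
  #|D| = #|equivalence_partition (@rooted_iso N H) D| * #|H|`!.
Proof.
move=> e0 N0 D; apply: card_uniform_partition; last first.
  by apply: equivalence_partitionP => t1 t2 t3 _ _ _; apply: rooted_iso_equiv.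
move=> _ /imsetP[t tD ->].
have [tt dt] : rooted_tree e t /\ [forall k, (root_degree t k)%:Z%R == d k].
  by apply/andP; move: tD; rewrite inE.
rewrite -card_perm_type -cardsT -(card_imset _ (relabel_inj e0 N0 tt)).
apply: eq_card => t'; rewrite !inE; apply/andP/imsetP.
  by case=> _ /rooted_isoP[p ->]; exists p.
case=> p _ ->; split; last by apply/rooted_isoP; exists p.
rewrite rooted_tree_relabel //=; apply/forallP=> k.
by rewrite root_degree_relabel (forallP dt).
Qed.

End Relabel.
End PlaneTrees.

(** * Permutations with labelled and rooted cycles *)

Section RootedPermutations.
Local Open Scope nat_scope.
Variable H : finType.

(** The total number m of cycles may exceed the number of labels: only the cycles
    of the chosen roots have a prescribed length. *)
Definition rooted_perms (K : finType) (m : nat) (c : K -> nat) :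
    {set {perm H} * {ffun K -> H}} :=
  [set sr : {perm H} * {ffun K -> H} |
    [&& #|porbits sr.1| == m, injectiveb (fun k => porbit sr.1 (sr.2 k))
      & [forall k, #|porbit sr.1 (sr.2 k)| == c k]]].

Lemma rooted_permsP (K : finType) m (c : K -> nat) (sr : {perm H} * {ffun K -> H}) :
  reflect [/\ #|porbits sr.1| = m, injective (fun k => porbit sr.1 (sr.2 k))
            & forall k, #|porbit sr.1 (sr.2 k)| = c k]
          (sr \in rooted_perms m c).
Proof.
rewrite inE; apply: (iffP and3P) => -[].
  by move=> /eqP-> /injectiveP ? /forallP dc; split=> // k; apply/eqP.
move=> -> ri dc; split; [exact: eqxx | exact/injectiveP | apply/forallP=> k].
by rewrite dc.
Qed.

Lemma expg_mod_porbit (s : {perm H}) x i :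
  (s ^+ (i %% #|porbit s x|))%g x = (s ^+ i)%g x.
Proof.
rewrite {2}(divn_eq i #|porbit s x|) expgD mulnC expgM permM.
congr ((s ^+ _)%g _); elim: (_ %/ _) => [|q IHq]; first by rewrite perm1.
by rewrite expgSr permM -IHq permX iter_porbit.
Qed.

Lemma porbit_exp_inj (s : {perm H}) x i j :
  i < #|porbit s x| -> j < #|porbit s x| ->
  (s ^+ i)%g x = (s ^+ j)%g x -> i = j.
Proof.
move=> ltis ltjs; rewrite !permX -!(nth_traject s ltis) -!(nth_traject s ltjs).
by move/eqP; rewrite nth_uniq ?size_traject ?uniq_traject_porbit // => /eqP.
Qed.

(** When every cycle carries a root, each element of H is reached from the root of
    its cycle in a unique number of steps less than the length of the cycle. *)
Section Coordinates.
Variables (K : finType) (c : K -> nat).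
Hypotheses (c0 : forall k, 0 < c k) (cH : \sum_k c k = #|H|).

Local Notation T := {k : K & 'I_(c k)}.
Let base k : T := Tagged (fun k => 'I_(c k)) (Ordinal (c0 k)).
Let turn (t : T) : T := Tagged (fun k => 'I_(c k)) (ordS (tagged t)).

Definition coordinates (sr : {perm H} * {ffun K -> H}) : {ffun T -> H} :=
  [ffun t : T => (sr.1 ^+ tagged t)%g (sr.2 (tag t))].

Let cardT : #|{: T}| = #|H|.
Proof.
rewrite card_tagged sumnE big_map big_enum /= -cH.
by apply: eq_bigr => k _; rewrite card_ord.
Qed.

Lemma coordinates_inj sr :
  sr \in rooted_perms #|K| c -> injective (coordinates sr).
Proof.
case/rooted_permsP=> _ ri dc [k i] [l j]; rewrite !ffunE /= => eq_kl.
have kl : k = l by apply: ri; rewrite -(porbit_perm _ i) eq_kl porbit_perm.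
case: l / kl j eq_kl => j /porbit_exp_inj eq_ij; congr Tagged; apply: val_inj.
by apply: eq_ij; rewrite dc.
Qed.

Lemma coordinates_turn sr t :
  sr \in rooted_perms #|K| c -> coordinates sr (turn t) = sr.1 (coordinates sr t).
Proof.
case/rooted_permsP=> _ _ dc; rewrite !ffunE -permM -expgSr /=.
by have := expg_mod_porbit sr.1 (sr.2 (tag t)) (tagged t).+1; rewrite dc.
Qed.

Lemma coordinates_determine : {in rooted_perms #|K| c &, injective coordinates}.
Proof.
move=> [s r] [s' r'] srP srP' eqF.
have -> : r = r'.
  apply/ffunP=> k; have /ffunP/(_ (base k)) := eqF.
  by rewrite !ffunE /= !perm1.
congr (_, _); apply/permP=> x.
have [g _ gK] := inj_card_bij (coordinates_inj srP) (eq_leq (esym cardT)).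
have := coordinates_turn (g x) srP; rewrite eqF (coordinates_turn _ srP') /=.
by rewrite -eqF gK.
Qed.

(** The permutation is [turn] transported along f, and the roots are the images
    of the positions 0. *)
Lemma coordinates_onto (f : {ffun T -> H}) :
  injective f -> exists2 sr, sr \in rooted_perms #|K| c & coordinates sr = f.
Proof.
move=> f_inj.
have [g fK gK] := inj_card_bij f_inj (eq_leq (esym cardT)).
have turn_inj : injective turn.
  move=> [k i] [l j] eq_kl; have kl : k = l by case: eq_kl.
  case: l / kl j eq_kl => j /eqP; rewrite /turn eq_Tagged /= => /eqP eq_ij.
  congr Tagged; exact: ordS_inj eq_ij.
have s_inj : injective (f \o turn \o g).
  by apply: inj_comp (can_inj gK); apply: inj_comp.
pose s := perm s_inj; pose r := [ffun k => f (base k)].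
have sE i k :
    (s ^+ i)%g (r k) =
    f (Tagged (fun k => 'I_(c k)) (Ordinal (ltn_pmod i (c0 k)))).
  elim: i => [|i IHi].
    by rewrite perm1 ffunE; congr (f (Tagged _ _)); apply: val_inj; rewrite /= mod0n.
  rewrite expgSr permM IHi permE /= fK; congr (f (Tagged _ _)); apply: val_inj => /=.
  by rewrite -addn1 modnDml addn1.
have orbE k : porbit s (r k) = [set f t | t : T & tag t == k].
  apply/setP=> x; apply/porbitP/imsetP => [[i ->]|[[l j]]].
    rewrite sE.
    exists (Tagged (fun k => 'I_(c k)) (Ordinal (ltn_pmod i (c0 k)))) => //.
    by rewrite inE eqxx.
  rewrite inE /= => /eqP lk; case: k / lk => ->.
  exists j; rewrite sE; congr (f (Tagged _ _)); apply: val_inj.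
  by rewrite /= modn_small.
have orb_inj : injective (fun k => porbit s (r k)).
  move=> k l /= eq_kl; have := porbit_id s (r k).
  by rewrite eq_kl orbE ffunE (mem_imset _ _ f_inj) inE => /eqP.
exists (s, r); last first.
  apply/ffunP=> -[k i]; rewrite ffunE /= sE; congr (f (Tagged _ _)).
  by apply: val_inj; rewrite /= modn_small.
apply/rooted_permsP; split=> //=.
- rewrite -[RHS]cardsT -(card_imset _ orb_inj); apply: eq_card => C.
  apply/imsetP/imsetP=> [[x _ ->]|[k _ ->]]; last by exists (r k).
  exists (tag (g x)); rewrite ?inE //; apply/eqP; rewrite eq_porbit_mem orbE.
  by apply/imsetP; exists (g x); rewrite ?inE.
- move=> k; rewrite orbE (card_imset _ f_inj).
  have Tk_inj : injective (fun i : 'I_(c k) => Tagged (fun k => 'I_(c k)) i).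
    by move=> i j /eqP; rewrite eq_Tagged => /eqP.
  rewrite -[RHS]card_ord -(card_imset 'I_(c k) Tk_inj); apply: eq_card => t.
  rewrite inE; apply/eqP/imsetP=> [<-|[i _ ->] //].
  by exists (tagged t); rewrite ?inE //; case: t.
Qed.

Lemma card_rooted_perms : #|rooted_perms #|K| c| = #|H|`!.
Proof.
rewrite -(card_in_imset coordinates_determine) -ffactnn -{2}cardT.
rewrite -card_inj_ffuns; apply: eq_card => f; rewrite inE.
apply/imsetP/injectiveP=> [[sr srP ->]|/coordinates_onto[sr srP <-]].
  exact: coordinates_inj.
by exists sr.
Qed.

End Coordinates.

(** A labelled section of [v] over Q is a bijection from J to Q together with a
    point in the fibre of each value; the product of the fibre sizes does not
    depend on the bijection. *)
Lemma card_labelled_sections (V J : finType) (v : H -> V) (Q : {set V}) :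
  #|Q| = #|J| ->
  #|[set R : {ffun J -> H} | injectiveb (v \o R) & [forall j, v (R j) \in Q]]| =
  #|J|`! * \prod_(w in Q) #|fiber v setT w|.
Proof.
move=> cQ; set Z := [set R | _ & _].
rewrite (card_fibers (f := fun R : {ffun J -> H} => [ffun j => v (R j)])
          (Y := [set g : {ffun J -> V} in ffun_on (mem Q) | injectiveb g])); last first.
  move=> R; rewrite !inE => /andP[/injectiveP vR /forallP vQ]; apply/andP; split.
    by apply/ffun_onP=> j; rewrite ffunE.
  by apply/injectiveP=> i j; rewrite !ffunE; apply: vR.
rewrite -(ffactnn #|J|) -{1}cQ -card_inj_ffuns_on -sum_nat_const.
apply: eq_bigr => g; rewrite inE => /andP[/ffun_onP gQ /injectiveP g_inj].
have imgQ : g @: setT = Q.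
  apply/eqP; rewrite eqEcard card_imset // cardsT cQ leqnn andbT.
  by apply/subsetP=> _ /imsetP[j _ ->].
rewrite -imgQ big_imset /=; last by move=> i j _ _; apply: g_inj.
transitivity #|family (fun j => mem (fiber v setT (g j)))|.
  apply: eq_card => R; rewrite inE; apply/andP/familyP=> [[_ /eqP Rg] j|Rg].
    by rewrite inE in_setT -Rg ffunE eqxx.
  have vR j : v (R j) = g j by apply/eqP; have := Rg j; rewrite inE in_setT.
  split; last by apply/eqP/ffunP=> j; rewrite ffunE.
  rewrite inE; apply/andP; split; last by apply/forallP=> j; rewrite vR gQ.
  by apply/injectiveP=> i j /=; rewrite !vR; apply: g_inj.
rewrite card_family foldrE big_map big_enum; apply: eq_bigl => j.
by rewrite !inE.
Qed.

End RootedPermutations.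

(** * Counting rooted trees *)

Section CountingRootedTrees.
Local Open Scope nat_scope.

Lemma card_rooted_trees (H : finType) (N e : nat) (c : 'I_N -> nat) :
  #|H| = e.+1.*2 ->
  #|[set t : rooted_graph N H | rooted_tree e.+1 t
      & [forall k, (root_degree t k)%:Z%R == (c k)%:Z%R]]| =
  \sum_(sr in rooted_perms H e.+2 c) e`! * \prod_(C in porbits sr.1) #|C|.
Proof.
move=> cH.
pose X := [set x : {perm H} * {perm H} * {ffun 'I_N -> H}
  | ((x.1.2, x.2) \in rooted_perms H e.+2 c)
    & (x.1.1 \in tree_matchings (porbit x.1.2) setT)].
transitivity #|X|.
  rewrite -(card_imset X (@Some_inj _)); apply: eq_card => -[[[a s] r]|].
    rewrite (mem_imset _ _ (@Some_inj _)) inE [RHS]inE /= plane_treeE cH eqxx /=.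
    rewrite [(s, r) \in _]inE /=.
    have -> : [forall k, (#|porbit s (r k)|)%:Z%R == (c k)%:Z%R] =
              [forall k, #|porbit s (r k)| == c k] by apply: eq_forallb.
    by rewrite -!andbA; congr (_ && _); rewrite andbC -!andbA.
  by rewrite !inE; apply/esym/imsetP=> -[].
rewrite (card_fibers (f := fun x => (x.1.2, x.2)) (Y := rooted_perms H e.+2 c)).
  apply: eq_bigr => -[s r] srP; have /rooted_permsP[/= cs _ _] := srP.
  rewrite -card_plane_matchings //.
  have pair_inj : injective (fun a : {perm H} => (a, s, r)) by move=> a b [].
  rewrite -(card_imset _ pair_inj); apply: eq_card => -[[a s'] r'].
  apply/setIdP/imsetP=> [[]|[b bT [-> -> ->]]].
    by rewrite inE => /andP[_ /= aT] /eqP[es er]; rewrite -es -er; exists a.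
  by split; [rewrite inE; apply/andP | exact: eqxx].
by move=> x; rewrite inE => /andP[].
Qed.

(** The labels in K are those of the cycles with a length prescribed by c, the
    labels in J those of all the other cycles. *)
Section Complete.
Variables (H K J : finType) (c : K -> nat).
Let m := #|K| + #|J|.

Definition complete_rooted_perms : {set {perm H} * {ffun K + J -> H}} :=
  [set sR : {perm H} * {ffun K + J -> H} |
    [&& #|porbits sR.1| == m, injectiveb (fun x => porbit sR.1 (sR.2 x))
      & [forall k, #|porbit sR.1 (sR.2 (inl k))| == c k]]].

Lemma complete_rooted_permsP (sR : {perm H} * {ffun K + J -> H}) :
  reflect [/\ #|porbits sR.1| = m, injective (fun x => porbit sR.1 (sR.2 x))
            & forall k, #|porbit sR.1 (sR.2 (inl k))| = c k]
          (sR \in complete_rooted_perms).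
Proof.
rewrite inE; apply: (iffP and3P) => -[].
  by move=> /eqP-> /injectiveP ? /forallP dc; split=> // k; apply/eqP.
move=> -> ri dc; split; [exact: eqxx | exact/injectiveP | apply/forallP=> k].
by rewrite dc.
Qed.

Definition extend_roots (r : {ffun K -> H}) (R : {ffun J -> H}) : {ffun K + J -> H} :=
  [ffun x => match x with inl k => r k | inr j => R j end].

(** Over a given (s, r), the completions are the labelled sections over the cycles
    without a root, so they carry the weight of these cycles. *)
Lemma complete_rooted_perms_weight :
  (\prod_k c k) * #|complete_rooted_perms| =
  #|J|`! * \sum_(sr in rooted_perms H m c) \prod_(C in porbits sr.1) #|C|.
Proof.
rewrite (card_fibers
          (f := fun sR : {perm H} * {ffun K + J -> H} =>
                  (sR.1, [ffun k => sR.2 (inl k)]))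
          (Y := rooted_perms H m c)); last first.
  move=> sR /complete_rooted_permsP[cs ri dc]; apply/rooted_permsP; split=> //=.
    by move=> k l; rewrite !ffunE => /ri[].
  by move=> k; rewrite ffunE.
rewrite !big_distrr; apply: eq_bigr => -[s r] srP.
have /rooted_permsP[/= cs ri dc] := srP.
pose im := (fun k => porbit s (r k)) @: setT; pose Q := porbits s :\: im.
have im_sub : im \subset porbits s by apply/subsetP=> _ /imsetP[k _ ->]; apply: imset_f.
have cQ : #|Q| = #|J|.
  by rewrite cardsDS // cs card_imset // cardsT addKn.
have -> : \prod_(C in porbits s) #|C| = (\prod_k c k) * \prod_(C in Q) #|C|.
  rewrite (big_setID im) /= (setIidPr im_sub) big_imset /=; last first.
    by move=> k l _ _; apply: ri.
  by congr (_ * _); apply: eq_big => [k|k _]; rewrite ?inE ?dc.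
rewrite mulnCA; congr (_ * _).
rewrite [X in _ = _ * X](eq_bigr (fun C => #|fiber (porbit s) setT C|)); last first.
  by move=> C /setDP[Cs _]; rewrite fiber_porbit.
rewrite -card_labelled_sections //.
have ext_inj : injective (fun R => (s, extend_roots r R)).
  move=> R R' [/ffunP eR]; apply/ffunP=> j; by have := eR (inr j); rewrite !ffunE.
rewrite -(card_imset _ ext_inj); apply: eq_card => -[s' R].
apply/setIdP/imsetP.
  case=> /complete_rooted_permsP[/= _ Ri _] /eqP[es er].
  rewrite {s'}es in Ri *.
  exists [ffun j => R (inr j)]; last first.
    by congr (_, _); apply/ffunP=> -[x|x]; rewrite ffunE -?er ffunE.
  rewrite inE; apply/andP; split.
    by apply/injectiveP=> i j /=; rewrite !ffunE => /Ri[].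
  apply/forallP=> j; rewrite !inE ffunE; apply/andP; split; last exact: imset_f.
  by apply/imsetP=> -[k _]; rewrite -er ffunE => /Ri.
case=> R' ; rewrite inE => /andP[/injectiveP R'i /forallP R'Q] [-> ->].
have nim k j : porbit s (R' j) <> porbit s (r k).
  by move=> ekj; have /setDP[_ /imsetP[]] := R'Q j; exists k.
split; last by apply/eqP; congr (_, _); apply/ffunP=> k; rewrite !ffunE.
apply/complete_rooted_permsP; split=> //= [x y|k]; last by rewrite ffunE.
rewrite !ffunE; case: x y => [k|j] [l|i].
- by move/ri->.
- by move=> ekj; case: (nim k i).
- by move=> ekj; case: (nim l j).
- by move/R'i->.
Qed.

Hypothesis c0 : forall k, 0 < c k.
(** The excess of the free cycle lengths over their minimum, which is 1 for each
    label in J; this excess is what the functions from J to ['I_n.+1] below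
    distribute. *)
Variable n : nat.
Hypothesis cH : #|H| = \sum_k c k + #|J| + n.

Lemma complete_degree_sum sR : sR \in complete_rooted_perms ->
  \sum_j #|porbit sR.1 (sR.2 (inr j))|.-1 = n.
Proof.
case/complete_rooted_permsP=> cs ri dc; case: sR => s R /= in cs ri dc *.
have imE : (fun x => porbit s (R x)) @: setT = porbits s.
  apply/eqP; rewrite eqEcard card_imset // cardsT card_sum cs leqnn andbT.
  by apply/subsetP=> _ /imsetP[x _ ->]; apply: imset_f.
have : #|H| = \sum_x #|porbit s (R x)|.
  rewrite -cardsT (card_sum_fibers (porbit s)) imset_porbit -imE.
  rewrite big_imset /=; last by move=> x y _ _; apply: ri.
  by apply: eq_big => [x|x _]; rewrite ?inE // fiber_porbit ?imset_f.
rewrite big_sumType /= (eq_bigr c) => [|k _]; last exact: dc.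
rewrite (eq_bigr (fun j => 1 + #|porbit s (R (inr j))|.-1)) => [|j _]; last first.
  by rewrite add1n prednK // lt0n card_porbit_neq0.
by rewrite big_split /= sum1_card cH -addnA => /addnI/addnI.
Qed.

Lemma card_complete_rooted_perms :
  #|complete_rooted_perms| =
  #|[set t : {ffun J -> 'I_n.+1} | \sum_j t j == n]| * #|H|`!.
Proof.
pose deg (sR : {perm H} * {ffun K + J -> H}) :=
  [ffun j : J => inord #|porbit sR.1 (sR.2 (inr j))|.-1 : 'I_n.+1].
have degE sR j : sR \in complete_rooted_perms ->
    deg sR j = #|porbit sR.1 (sR.2 (inr j))|.-1 :> nat.
  move=> sRP; rewrite ffunE inordK // ltnS -(complete_degree_sum sRP).
  by rewrite (bigD1 j) //= leq_addr.
rewrite (card_fibers (f := deg) (Y := [set t : {ffun J -> 'I_n.+1} | \sum_j t j == n])).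
  rewrite -sum_nat_const; apply: eq_bigr => t; rewrite inE => /eqP tn.
  pose d (x : K + J) := match x with inl k => c k | inr j => (t j).+1 end.
  rewrite -(@card_rooted_perms H (K + J)%type d); last 2 first.
  - by case=> [k|j] //=; apply: c0.
  - rewrite big_sumType /= cH (eq_bigr (fun j => 1 + t j)) => [|j _] //.
    by rewrite big_split /= sum1_card tn addnA.
  apply: eq_card => -[s R]; apply/setIdP/rooted_permsP.
    case=> sRP /eqP st; have /complete_rooted_permsP[cs ri dc] := sRP.
    split; rewrite ?card_sum //; case=> [k|j] //=.
    by rewrite -st degE // prednK // lt0n card_porbit_neq0.
  rewrite card_sum => -[cs ri dc].
  have sRP : (s, R) \in complete_rooted_perms.
    by apply/complete_rooted_permsP; split=> // k; rewrite dc.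
  split=> //; apply/eqP/ffunP=> j; apply: val_inj.
  by rewrite /= degE //= (dc (inr j)).
move=> sR sRP; rewrite inE -[X in _ == X](complete_degree_sum sRP).
by apply/eqP/eq_bigr => j _; apply: degE.
Qed.

End Complete.

Lemma card_ffun_compositions m n :
  #|[set t : {ffun 'I_m.+1 -> 'I_n.+1} | \sum_j t j == n]| = 'C(m + n, m).
Proof.
rewrite -card_ord_partitions.
pose f (t : m.+1.-tuple 'I_n.+1) := [ffun j => tnth t j].
have f_inj : injective f.
  by move=> t u /ffunP ftu; apply: eq_from_tnth => j; have := ftu j; rewrite !ffunE.
rewrite -(card_imset _ f_inj); apply: eq_card => t; rewrite inE.
apply/eqP/imsetP=> [tn|[u]].
  exists [tuple t j | j < m.+1]; last by apply/ffunP=> j; rewrite ffunE tnth_mktuple.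
  rewrite inE big_tuple -[X in _ == X]tn; apply/eqP/eq_bigr => j _.
  by rewrite tnth_mktuple.
rewrite inE big_tuple => /eqP un ->; rewrite -[RHS]un.
by apply: eq_bigr => j _; rewrite ffunE.
Qed.

Lemma card_ffun_compositions0 :
  #|[set t : {ffun 'I_0 -> 'I_1} | \sum_j t j == 0]| = 1.
Proof.
rewrite -[RHS](_ : #|{ffun 'I_0 -> 'I_1}| = 1); last by rewrite card_ffun !card_ord.
by apply: eq_card => t; rewrite inE big_ord0.
Qed.

Lemma eq_tree_count (N e : nat) (d d' : 'I_N -> int) :
  d =1 d' -> tree_count e d = tree_count e d'.
Proof.
move=> dd'; congr #|pred_of_set (equivalence_partition _ _)|.
by apply/setP=> t; rewrite !inE; congr (_ && _); apply: eq_forallb => k; rewrite (dd' k).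
Qed.

Lemma tree_count0 (N : nat) (d : 'I_N -> int) :
  tree_count 0 d = (N == 1) && [forall k, d k == 0%R] :> nat.
Proof.
rewrite /tree_count /equivalence_partition.
case: (boolP (_ && _)) => [/andP[N1 /forallP d0]|Nd].
  rewrite (_ : [set t | _ & _] = [set None]) ?imset_set1 ?cards1 //.
  apply/setP=> -[[[a s] r]|]; rewrite !inE //= N1 /=; apply/forallP=> k.
  by rewrite (eqP (d0 k)).
rewrite (_ : [set t | _ & _] = set0) ?imset0 ?cards0 //.
apply/setP=> -[[[a s] r]|]; rewrite !inE //=; apply: contraNF Nd => /andP[-> /forallP d0].
by apply/forallP=> k; rewrite eq_sym d0.
Qed.

(** Here M is the number of vertices without a root, and n is what their degrees
    have in excess of 1 altogether. *)
Theorem tree_count_compositions (N e M n : nat) (c : 'I_N -> nat) :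
  0 < N -> N + M = e.+2 -> (forall k, 0 < c k) ->
  e.+1.*2 = \sum_k c k + M + n ->
  M`! * tree_count e.+1 (fun k => (c k)%:Z%R) =
  e`! * #|[set t : {ffun 'I_M -> 'I_n.+1} | \sum_j t j == n]| * \prod_k c k.
Proof.
move=> N0 NM c0 De; set Y := #|[set _ | _]|.
have cH : #|'I_(e.+1.*2)| = e.+1.*2 by rewrite card_ord.
have NMc : #|'I_N| + #|'I_M| = e.+2 by rewrite !card_ord.
apply/eqP; rewrite -(eqn_pmul2r (fact_gt0 #|'I_(e.+1.*2)|)) -mulnA /tree_count.
rewrite -card_isoclasses // card_rooted_trees // -big_distrr /= -NMc.
have := complete_rooted_perms_weight 'I_(e.+1.*2) 'I_M c.
rewrite card_ord [#|'I_M|]card_ord mulnCA => <-.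
rewrite (@card_complete_rooted_perms _ _ 'I_M c c0 n) -/Y; last first.
  by rewrite cH De card_ord.
apply/eqP; ring.
Qed.

End CountingRootedTrees.

Theorem theorem3 (N e : nat) (d : 'I_N -> int) (hN : (1 <= N)%N) :
  ((1 <= e)%N ->
   (N - 1 <= e)%N ->
   (forall i, 0 < d i /\ d i <= e%:Z) ->
   \sum_(i < N) d i <= e%:Z + N%:Z - 1 ->
   (N = e.+1 <-> \sum_(i < N) d i = 2 * e%:Z) ->
   ((2 <= e)%N -> (#|[set i | d i == 1%R]| <= e)%N) ->
   (e = 1%N -> (#|[set i | d i == 1%R]| <= 2)%N) ->
   (tree_count e d)%:R =
     ((e - 1)`!)%:R / ((e + 1 - N)`!)%:R
     * (binz (2 * e%:Z - 1 - \sum_(i < N) d i) (e%:Z - N%:Z))%:R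
     * \prod_(j < N) (d j)%:~R :> rat)
  /\ (e = 0%N -> (tree_count e d <> 0%N <-> N = 1%N /\ forall i, d i = 0))
  /\ tree_count 0 (fun _ : 'I_1 => 0 : int) = 1%N.
Proof.
split=> [e0 Ne d_bnd Dle NE _ _|].
  case: e e0 Ne d_bnd Dle NE => // e _ Ne d_bnd Dle NE.
  pose c i := `|d i|%N; have dE : d =1 (fun i => (c i)%:Z).
    by move=> i; rewrite /c gez0_abs // ltW //; case: (d_bnd i).
  have c0 k : (0 < c k)%N by have [] := d_bnd k; rewrite dE.
  pose D := (\sum_k c k)%N; have sumD : \sum_k d k = D%:Z.
    by rewrite (eq_bigr _ (fun k _ => dE k)) (big_morph Posz PoszD (erefl _)).
  rewrite sumD in Dle NE *.
  pose M := (e.+2 - N)%N; pose n := (e.+1.*2 - D - M)%N.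
  have NM : (N + M = e.+2)%N by rewrite /M; lia.
  have De : (e.+1.*2 = D + M + n)%N by rewrite /n; lia.
  have := tree_count_compositions hN NM c0 De; rewrite -(eq_tree_count _ dE) => count.
  have -> : binz (2 * e.+1%:Z - 1 - D%:Z) (e.+1%:Z - N%:Z) =
            #|[set t : {ffun 'I_M -> 'I_n.+1} | (\sum_j t j)%N == n]|.
    have D2 : M = 0%N -> D = e.+1.*2 by move=> M0; have [/(_ _)D2 _] := NE; lia.
    clearbody n; clearbody M; case: M NM De D2 {count} => [|m] NM De D2.
      have -> : 2 * e.+1%:Z - 1 - D%:Z = Negz 0 by rewrite NegzE; lia.
      have -> : e.+1%:Z - N%:Z = Negz 0 by rewrite NegzE; lia.
      have n0 : n = 0%N by lia.
      by rewrite n0 card_ffun_compositions0.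
    have -> : 2 * e.+1%:Z - 1 - D%:Z = (m + n)%N by lia.
    have -> : e.+1%:Z - N%:Z = m by lia.
    by rewrite card_ffun_compositions.
  have -> : \prod_j (d j)%:~R = (\prod_j c j)%:R :> rat.
    by rewrite natr_prod; apply: eq_bigr => j _; rewrite dE.
  have M0 : (M`!)%:R != 0 :> rat by rewrite pnatr_eq0 -lt0n fact_gt0.
  have -> : (e.+1 + 1 - N = M)%N by rewrite /M addn1.
  apply: (mulfI M0); rewrite -natrM count !natrM subn1 /=.
  by field.
split=> [->|]; last by rewrite tree_count0; apply/eqP; rewrite eqb1; apply/forallP.
rewrite tree_count0; split=> [|[N1 d0]].
  by case: andP => // -[/eqP N1 /forallP d0] _; split=> // i; apply/eqP.
have -> : [forall k, d k == 0] by apply/forallP=> k; rewrite d0.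
by rewrite N1.
Qed.
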